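(* Let $\mathbb{X}$ be a finite set, $p_X$ a probability mass function on $\mathbb{X}$ with $p_X(x)>0$ for all $x$, $\mathcal{H}_A$ a finite-dimensional Hilbert space, and $\{\rho_A^x\}_{x\in\mathbb{X}}$ density operators on $\mathcal{H}_A$, forming the ensemble $\mathcal{E}=\{p_X(x),\rho_A^x\}_{x\in\mathbb{X}}$. Then \[ I_{acc}(\mathcal{E})\leq\chi(\mathcal{E})\leq\mathcal{B}(X\rightarrow A)_{\rho_A}\leq\mathcal{R}(X\rightarrow A)_{\rho_A}. \]
   Context: All logarithms are base 2. Accessible information: $I_{acc}(\mathcal{E})=\sup_{\{F_y\}}I_1(X;Y)$, where the supremum is over POVMs $\{F_y\}_{y\in\mathbb{Y}}$ on $\mathcal{H}_A$ with finite outcome set, $Y$ is the outcome with $\mathbb{P}\{Y=y\mid X=x\}=\operatorname{tr}(\rho_A^xF_y)$, and $I_1$ is the (Shannon) mutual information of $(X,Y)$ with $X\sim p_X$. Holevo information: $\chi(\mathcal{E})=H(\rho_A)-\sum_{x}p_X(x)H(\rho_A^x)$ with $\rho_A=\sum_xp_X(x)\rho_A^x$ and $H(\rho)=-\operatorname{tr}(\rho\log\rho)$. For a density operator $\rho$ and positive semi-definite $\sigma$, $\widetilde{D}_\infty(\rho\|\sigma)=\log\inf\{\mu\in\mathbb{R}:\rho\leq\mu\sigma\}$ ($+\infty$ if $\operatorname{supp}\rho\not\subseteq\operatorname{supp}\sigma$). $\Delta(\mathbb{X})$ is the set of probability mass functions on $\mathbb{X}$; $\mathcal{B}(X\rightarrow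 A)_{\rho_A}=\min_{\pi\in\Delta(\mathbb{X})}\max_{x}\widetilde{D}_\infty\big(\rho_A^x\|\sum_{x'}\pi(x')\rho_A^{x'}\big)$ and $\mathcal{R}(X\rightarrow A)_{\rho_A}=\max_{x,x'}\widetilde{D}_\infty(\rho_A^x\|\rho_A^{x'})$. *)

(* Defs.v *)
From HB Require Import structures.
From mathcomp Require Import all_boot all_order all_algebra.
From mathcomp Require Import complex.
From mathcomp Require Import all_classical all_reals all_analysis.

Set Implicit Arguments.
Unset Strict Implicit.
Unset Printing Implicit Defensive.

Import Order.TTheory GRing.Theory Num.Theory.
Local Open Scope ring_scope.
Local Open Scope complex_scope.
Local Open Scope classical_set_scope.

Section QuantumDefs.
Variable R : realType.
Local Notation C := R[i].

Definition log2 (x : R) : R := ln x / ln 2.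

Definition xlog2x (x : R) : R := if x == 0 then 0 else x * log2 x.

Definition adjmx m n (A : 'M[C]_(m, n)) : 'M[C]_(n, m) := (map_mx Num.conj A)^T.

Definition psdmx n (A : 'M[C]_n) : Prop :=
  A \is hermsymmx /\
  forall v : 'rV[C]_n, 0 <= (v *m A *m adjmx v) 0 0.

Definition loewner n (A B : 'M[C]_n) : Prop := psdmx (B - A).

Definition density n (rho : 'M[C]_n) : Prop := psdmx rho /\ \tr rho = 1.

(** von Neumann entropy H(rho) = - tr (rho log rho) = - sum_i l_i log l_i
    where the l_i are the eigenvalues of rho (from the spectral decomposition
    rho = U^-1 diag(l) U of the normal matrix rho). *)
Definition vn_entropy n (rho : 'M[C]_n) : R :=
  - \sum_(i < n) xlog2x (complex.Re (spectral_diag rho 0 i)).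

Definition povm n m (F : 'I_m -> 'M[C]_n) : Prop :=
  (forall y, psdmx (F y)) /\ \sum_(y < m) F y = 1%:M.

(** Shannon mutual information I_1(X;Y) of the joint law
    P(X = x, Y = y) = pX x * W x y  (conventions 0 log 0 = 0). *)
Definition mutual_info (X : finType) m (pX : X -> R) (W : X -> 'I_m -> R) : R :=
  let pY := fun y => \sum_(x : X) pX x * W x y in
  \sum_(x : X) \sum_(y < m)
     (if pX x * W x y == 0 then 0
      else pX x * W x y * log2 (pX x * W x y / (pX x * pY y))).

Definition meas_prob (X : finType) n m (rho : X -> 'M[C]_n)
  (F : 'I_m -> 'M[C]_n) (x : X) (y : 'I_m) : R :=
  complex.Re (\tr (rho x *m F y)).

Definition acc_info (X : finType) n (pX : X -> R) (rho : X -> 'M[C]_n) : \bar R :=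
  ereal_sup [set (mutual_info pX (meas_prob rho (projT2 F)))%:E
            | F in [set F : {m : nat & 'I_m -> 'M[C]_n} | povm (projT2 F)] ]%classic.

Definition avg_state (X : finType) n (pX : X -> R) (rho : X -> 'M[C]_n) : 'M[C]_n :=
  \sum_(x : X) (pX x)%:C *: rho x.

Definition holevo (X : finType) n (pX : X -> R) (rho : X -> 'M[C]_n) : R :=
  vn_entropy (avg_state pX rho) - \sum_(x : X) pX x * vn_entropy (rho x).

(** max-relative entropy (sandwiched Renyi, alpha = oo):
    log inf { mu | rho <= mu sigma }, and +oo if supp rho is not in supp sigma.
    For Hermitian matrices, the row-space inclusion (rho <= sigma)%MS is
    exactly the inclusion of supports. *)
Definition Dmax n (rho sigma : 'M[C]_n) : \bar R :=
  if (rho <= sigma)%MS then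
    (log2 (inf [set mu : R | loewner rho (mu%:C *: sigma)]))%:E
  else +oo%E.

Definition pmf (X : finType) (pi : X -> R) : Prop :=
  (forall x, 0 <= pi x) /\ \sum_(x : X) pi x = 1.

Definition Bquant (X : finType) n (rho : X -> 'M[C]_n) : \bar R :=
  ereal_inf [set (\big[maxe/-oo%E]_(x : X) Dmax (rho x) (avg_state pi rho))%E
            | pi in [set pi : X -> R | pmf pi] ]%classic.

Definition Rquant (X : finType) n (rho : X -> 'M[C]_n) : \bar R :=
  (\big[maxe/-oo%E]_(x : X) \big[maxe/-oo%E]_(x' : X) Dmax (rho x) (rho x'))%E.

End QuantumDefs.

(* Main.v *)
Require Import Defs.
From HB Require Import structures.
From mathcomp Require Import all_boot all_order all_algebra.
From mathcomp Require Import complex.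
From mathcomp Require Import all_classical all_reals all_analysis.
From mathcomp Require Import ring lra.

Set Implicit Arguments.
Unset Strict Implicit.
Unset Printing Implicit Defensive.

Import Order.TTheory GRing.Theory Num.Theory.
Local Open Scope ring_scope.
Local Open Scope complex_scope.

(** The Holevo information is the average of the relative entropies
    [D(rho_x || rho)].  Writing [ln x] as the limit of Riemann sums of
    [(x - 1) / (1 - s + s x)] over [s] in [(0, 1]] reduces inequalities between
    relative entropies to inequalities, for each [s], between the quantities
    [Q_s = \sum_ij |<u_i, v_j>|^2 l_i^2 / ((1 - s) l_i + s m_j)], where [(u_i, l_i)]
    and [(v_j, m_j)] are the eigenpairs of [rho] and [sigma].  Moreover [Q_s] is
    the maximum over all matrices [Z] of
    [2 Re tr(rho Z) - (1 - s) tr(rho Z Z') - s tr(sigma Z' Z)], with [Z'] the adjoint.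
    - For a POVM [F], the choice [Z = \sum_y z_y F_y] together with
      [Z^2 <= \sum_y z_y^2 F_y] shows that measuring decreases [Q_s], hence the
      relative entropy; this is the Holevo bound.
    - If [rho <= mu sigma], replacing [sigma] by [rho / mu] increases the
      expression to be maximized, so that [Q_s <= 1 / (1 - s + s / mu)] and
      [D(rho || sigma) <= log mu].
    Finally [\sum_x p_x D(rho_x || sigma)] exceeds the Holevo information by
    [D(rho || sigma) >= 0], and point masses [pi] give the last inequality. *)

(** * Riemann sums for the logarithm *)

Lemma lnB_le (R : realType) (a b : R) : 0 < a -> 0 < b ->
  ln a - ln b <= (a - b) / b.
Proof.
move=> a0 b0; rewrite -ln_div ?posrE//.
have -> : a / b = 1 + (a - b) / b by field; rewrite gt_eqF.
apply: le_ln1Dx.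
have := divr_gt0 a0 b0; rewrite mulrBl divff ?gt_eqF//; lra.
Qed.

Lemma lnB_ge (R : realType) (a b : R) : 0 < a -> 0 < b ->
  (a - b) / a <= ln a - ln b.
Proof.
move=> a0 b0; rewrite -[leRHS]opprB lerNr -mulNr opprB; exact: lnB_le.
Qed.

(** The right-endpoint Riemann sum of (x - 1) / (1 - s + s x) over [0, 1]. At s = k.+1 / m, each
    summand is a constant minus a nonnegative multiple of (1 - s + s x)^-1, the function averaged in
    [le_sum_ln]. *)
Definition ln_riemann (R : realType) (m : nat) (x : R) : R :=
  \sum_(0 <= k < m) k.+1%:R^-1 * (1 - (1 - k.+1%:R / m%:R + k.+1%:R / m%:R * x)^-1).

(** The points [a k] run from 1 to x in equal steps, and [ln x] is the telescoping sum of the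
    increments of [ln]. Each increment lies between the right- and left-endpoint rectangles, and the
    total gap between these telescopes too. *)
Lemma ln_riemann_bounds (R : realType) (m : nat) (x : R) : 0 < x -> (0 < m)%N ->
  ln_riemann m x <= ln x <= ln_riemann m x + (x - 1) ^+ 2 / x / m%:R.
Proof.
move=> x0 m0.
have m0R : 0 < m%:R :> R by rewrite ltr0n.
pose a k : R := 1 - k%:R / m%:R + k%:R / m%:R * x.
have a_gt0 k : (k <= m)%N -> 0 < a k.
  move=> km; have t0 : 0 <= k%:R / m%:R :> R by rewrite divr_ge0.
  have t1 : k%:R / m%:R <= 1 :> R by rewrite ler_pdivrMr// mul1r ler_nat.
  rewrite /a; have [->|] := eqVneq (k%:R / m%:R : R) 1; first by lra.
  move=> tn; apply: ltr_pwDl; last by rewrite mulr_ge0// ltW.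
  by rewrite subr_gt0 lt_neqAle tn.
have aB k : a k.+1 - a k = (x - 1) / m%:R.
  by rewrite /a -natr1; field; rewrite gt_eqF.
have a0 : a 0%N = 1 by rewrite /a mul0r mul0r; lra.
have am : a m = x by rewrite /a divff ?gt_eqF//; lra.
have lnE : ln x = \sum_(0 <= k < m) (ln (a k.+1) - ln (a k)).
  by rewrite telescope_sumr// am a0 ln1 subr0.
have LE : ln_riemann m x = \sum_(0 <= k < m) (a k.+1 - a k) / a k.+1.
  apply: eq_big_nat => k /andP[_ km]; rewrite aB.
  have := a_gt0 _ km; rewrite /a => h.
  have k0 : k.+1%:R != 0 :> R by rewrite pnatr_eq0.
  move: k0 h; move: (k.+1%:R : R) => c c0 h.
  field; rewrite c0 (gt_eqF m0R) /= andbT.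
  have -> : m%:R - c + c * x = m%:R * (1 - c / m%:R + c / m%:R * x).
    by field; rewrite gt_eqF.
  by rewrite gt_eqF// mulr_gt0.
apply/andP; split.
  rewrite LE lnE; apply: ler_sum_nat => k /andP[_ km].
  by apply: lnB_ge; apply: a_gt0 => //; apply: ltnW.
have -> : (x - 1) ^+ 2 / x / m%:R =
    \sum_(0 <= k < m) ((- ((x - 1) / m%:R / a k.+1)) - - ((x - 1) / m%:R / a k)).
  rewrite (telescope_sumr (fun k => - ((x - 1) / m%:R / a k)))// am a0.
  by field; rewrite !gt_eqF.
rewrite LE lnE -big_split/=; apply: ler_sum_nat => k /andP[_ km].
rewrite aB opprK addrA subrr add0r -(aB k).
by apply: lnB_le; apply: a_gt0 => //; apply: ltnW.
Qed.

(* The hypothesis compares the two averages of [x |-> (1 - s + s x)^-1], and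
   [- ln] is a limit of nonnegative combinations of these functions. *)
Lemma le_sum_ln (R : realType) (A B : finType) (w x : A -> R) (v y : B -> R) :
  (forall a, 0 <= w a) -> (forall b, 0 <= v b) ->
  (forall a, w a != 0 -> 0 < x a) -> (forall b, v b != 0 -> 0 < y b) ->
  \sum_a w a = \sum_b v b ->
  (forall s, 0 < s -> s <= 1 ->
    \sum_b v b * (1 - s + s * y b)^-1 <= \sum_a w a * (1 - s + s * x a)^-1) ->
  \sum_a w a * ln (x a) <= \sum_b v b * ln (y b).
Proof.
move=> w0 v0 wx vy wv H.
(* Riemann sums bound [ln] from below, so the error term K / m falls on the left-hand sum alone. *)
pose K := \sum_a w a * ((x a - 1) ^+ 2 / x a).
have K0 : 0 <= K.
  apply: sumr_ge0 => a _; have [->|/wx xa] := eqVneq (w a) 0.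
    by rewrite mul0r.
  by rewrite mulr_ge0// divr_ge0 ?sqr_ge0// ltW.
have bound m : (0 < m)%N -> \sum_a w a * ln (x a) <= \sum_b v b * ln (y b) + K / m%:R.
  move=> m0; have m0R : 0 < m%:R :> R by rewrite ltr0n.
  have le1 : \sum_a w a * ln (x a) <= \sum_a w a * ln_riemann m (x a) + K / m%:R.
    rewrite /K big_distrl -big_split/=; apply: ler_sum => a _.
    have [->|/wx xa] := eqVneq (w a) 0; first by rewrite !mul0r addr0.
    rewrite -mulrA -mulrDr ler_wpM2l//.
    by have /andP[] := ln_riemann_bounds xa m0.
  have le2 : \sum_b v b * ln_riemann m (y b) <= \sum_b v b * ln (y b).
    apply: ler_sum => b _.
    have [->|/vy yb] := eqVneq (v b) 0; first by rewrite !mul0r.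
    rewrite ler_wpM2l//.
    by have /andP[] := ln_riemann_bounds yb m0.
  apply: (le_trans le1); rewrite lerD2r; apply: le_trans le2.
  (* The constants add up to multiples of the total weight, equal on both sides by [wv]; the rest is
     compared by [H] at s = k.+1 / m. *)
  have E (T : finType) (u z : T -> R) : \sum_t u t * ln_riemann m (z t) =
     \sum_(0 <= k < m) k.+1%:R^-1 * (\sum_t u t -
       \sum_t u t * (1 - k.+1%:R / m%:R + k.+1%:R / m%:R * z t)^-1).
    under eq_bigr do rewrite /ln_riemann big_distrr/=.
    rewrite exchange_big/=; apply: eq_bigr => k _.
    rewrite -sumrB big_distrr/=; apply: eq_bigr => t _; ring.
  rewrite !E wv; apply: ler_sum_nat => k /andP[_ km].
  rewrite ler_wpM2l ?invr_ge0// lerD2l lerN2; apply: H.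
    by rewrite divr_gt0// ltr0n.
  by rewrite ler_pdivrMr// mul1r ler_nat.
apply/ler_addgt0Pr => e e0.
(* This m exceeds K / e, so the error K / m is below e. *)
pose m := (Num.truncn (K / e)).+1.
apply: (le_trans (bound m _)) => //; rewrite lerD2l.
rewrite ler_pdivrMr ?ltr0n// -ler_pdivrMl// mulrC; apply/ltW.
by rewrite /m; exact: truncnS_gt.
Qed.

(** * Squared moduli and completing the square *)

Section SquaredModulus.
Variable R : realType.
Local Notation C := R[i].
Implicit Types z t : C.

Definition sqmod z : R := complex.Re z ^+ 2 + complex.Im z ^+ 2.

Lemma sqmod_ge0 z : 0 <= sqmod z.
Proof. by rewrite addr_ge0 ?sqr_ge0. Qed.

Lemma mul_conj_sqmod z : z * Num.conj z = (sqmod z)%:C.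
Proof. by rewrite -normCK -add_Re2_Im2. Qed.

Lemma Re_add z t : complex.Re (z + t) = complex.Re z + complex.Re t.
Proof. by case: z; case: t. Qed.

Lemma Re_sub z t : complex.Re (z - t) = complex.Re z - complex.Re t.
Proof. by case: z; case: t. Qed.

Lemma Re_scale (a : R) z : complex.Re (a%:C * z) = a * complex.Re z.
Proof. by case: z => x y /=; rewrite mul0r subr0. Qed.

Lemma Re_sum (I : finType) (P : pred I) (F : I -> C) :
  complex.Re (\sum_(i | P i) F i) = \sum_(i | P i) complex.Re (F i).
Proof. by apply: (big_morph _ Re_add). Qed.

Lemma real_complex_sum (I : finType) (F : I -> R) :
  (\sum_i F i)%:C = \sum_i (F i)%:C.
Proof. exact: (rmorph_sum (real_complex R)). Qed.

Lemma Re_ge0 z : 0 <= z -> 0 <= complex.Re z.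
Proof. by rewrite lecE => /andP[]. Qed.

(** Multiplied by a, the gap between the two sides is |a z - l t|^2; hence the maximizer z = (l / a)
    t in [quadratic_eq]. *)
Lemma quadratic_le z t (l a : R) : 0 < a ->
  2 * (l * complex.Re (z * Num.conj t)) - a * sqmod z <= l ^+ 2 * sqmod t / a.
Proof.
move=> a0; rewrite ler_pdivlMr// -subr_ge0.
case: z t => [x y] [u v]; rewrite /sqmod /=.
have -> : (l ^+ 2 * (u ^+ 2 + v ^+ 2) -
   (2 * (l * (x * u - y * - v)) - a * (x ^+ 2 + y ^+ 2)) * a) =
   (a * x - l * u) ^+ 2 + (a * y - l * v) ^+ 2 by ring.
by rewrite addr_ge0 ?sqr_ge0.
Qed.

Lemma quadratic_eq t (l a : R) : a != 0 ->
  2 * (l * complex.Re ((l / a)%:C * t * Num.conj t)) - a * sqmod ((l / a)%:C * t)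
    = l ^+ 2 * sqmod t / a.
Proof.
move=> a0; case: t => [u v]; rewrite /sqmod /=.
field; exact: a0.
Qed.

End SquaredModulus.

(** * Adjoints, positive semi-definite matrices and traces *)

Section Matrices.
Local Open Scope sesquilinear_scope.
Variable R : realType.
Local Notation C := R[i].

Lemma adjmxE m n (A : 'M[C]_(m, n)) i j : adjmx A i j = Num.conj (A j i).
Proof. by rewrite !mxE. Qed.

Lemma adjmxM m n p (A : 'M[C]_(m, n)) (B : 'M[C]_(n, p)) :
  adjmx (A *m B) = adjmx B *m adjmx A.
Proof. by rewrite /adjmx map_mxM trmx_mul. Qed.

Lemma adjmxK m n (A : 'M[C]_(m, n)) : adjmx (adjmx A) = A.
Proof. by apply/matrixP => i j; rewrite !adjmxE conjCK. Qed.

Lemma adjmxD m n (A B : 'M[C]_(m, n)) : adjmx (A + B) = adjmx A + adjmx B.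
Proof. by apply/matrixP => i j; rewrite !mxE rmorphD. Qed.

Lemma adjmxB m n (A B : 'M[C]_(m, n)) : adjmx (A - B) = adjmx A - adjmx B.
Proof. by apply/matrixP => i j; rewrite !mxE rmorphB. Qed.

Lemma adjmx_sum m n (I : finType) (F : I -> 'M[C]_(m, n)) :
  adjmx (\sum_i F i) = \sum_i adjmx (F i).
Proof.
by apply: (big_morph _ (@adjmxD m n)); apply/matrixP=> i j; rewrite !mxE rmorph0.
Qed.

Lemma adjmxZ m n (a : R) (A : 'M[C]_(m, n)) : adjmx (a%:C *: A) = a%:C *: adjmx A.
Proof.
by apply/matrixP => i j; rewrite !mxE rmorphM /=; congr (_ * _); apply: conjc_real.
Qed.

Lemma adjmx1 n : adjmx (1%:M : 'M[C]_n) = 1%:M.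
Proof. by apply/matrixP => i j; rewrite !mxE eq_sym conjC_nat. Qed.

Lemma hermsymmx_adj n (A : 'M[C]_n) : A \is hermsymmx <-> adjmx A = A.
Proof.
split.
  by move=> /is_hermitianmxP hA; rewrite [RHS]hA expr0 scale1r /adjmx map_trmx.
by move=> hA; apply/is_hermitianmxP; rewrite expr0 scale1r -map_trmx -/(adjmx A) hA.
Qed.

Lemma psdmx_adj n (A : 'M[C]_n) : psdmx A -> adjmx A = A.
Proof. by case=> /hermsymmx_adj. Qed.

Lemma psdmx_congr n (A G : 'M[C]_n) : psdmx A -> psdmx (G *m A *m adjmx G).
Proof.
move=> [/hermsymmx_adj hA A0]; split.
  by apply/hermsymmx_adj; rewrite !adjmxM adjmxK hA mulmxA.
by move=> v; have := A0 (v *m G); rewrite adjmxM !mulmxA.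
Qed.

Lemma psdmx1 n : psdmx (1%:M : 'M[C]_n).
Proof.
split; first exact/hermsymmx_adj/adjmx1.
move=> v; rewrite mulmx1 mxE sumr_ge0// => i _.
by rewrite adjmxE mul_conjC_ge0.
Qed.

Lemma psdmx_diag_ge0 n (A V : 'M[C]_n) i :
  psdmx A -> 0 <= (V *m A *m adjmx V) i i.
Proof.
move=> /(psdmx_congr V) [_ /(_ (delta_mx 0 i))].
rewrite -rowE mxE (bigD1 i)//= big1 ?addr0 => [|j ji]; last first.
  by rewrite adjmxE !mxE eqxx (negbTE ji) conjC0 mulr0.
by rewrite adjmxE [row _ _ _ _]mxE [delta_mx _ _ _ _]mxE !eqxx conjC1 mulr1.
Qed.

Lemma psdmx_avg (X : finType) n (p : X -> R) (rho : X -> 'M[C]_n) :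
  (forall x, 0 <= p x) -> (forall x, psdmx (rho x)) -> psdmx (avg_state p rho).
Proof.
move=> p0 h; split.
  apply/hermsymmx_adj; rewrite /avg_state adjmx_sum; apply: eq_bigr => x _.
  by rewrite adjmxZ psdmx_adj.
move=> v; rewrite /avg_state mulmx_sumr mulmx_suml summxE sumr_ge0// => x _.
rewrite -scalemxAr -scalemxAl mxE mulr_ge0 ?ler0c//.
by case: (h x).
Qed.

Definition rtr n (A : 'M[C]_n) : R := complex.Re (\tr A).

Lemma rtrD n (A B : 'M[C]_n) : rtr (A + B) = rtr A + rtr B.
Proof. by rewrite /rtr mxtraceD Re_add. Qed.

Lemma rtrB n (A B : 'M[C]_n) : rtr (A - B) = rtr A - rtr B.
Proof. by rewrite /rtr raddfB Re_sub. Qed.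

Lemma rtrZ n (a : R) (A : 'M[C]_n) : rtr (a%:C *: A) = a * rtr A.
Proof. by rewrite /rtr mxtraceZ Re_scale. Qed.

Lemma rtr_sum n (I : finType) (F : I -> 'M[C]_n) :
  rtr (\sum_i F i) = \sum_i rtr (F i).
Proof. by apply: (big_morph _ (@rtrD n)); rewrite /rtr mxtrace0. Qed.

Lemma rtrC n (A B : 'M[C]_n) : rtr (A *m B) = rtr (B *m A).
Proof. by rewrite /rtr mxtrace_mulC. Qed.

(** * Eigendecompositions and changes of eigenbasis *)

Definition rdiag n (l : 'I_n -> R) : 'M[C]_n := diag_mx (\row_i (l i)%:C).

Lemma rdiag_mulE n (l : 'I_n -> R) (B : 'M[C]_n) i j :
  (rdiag l *m B) i j = (l i)%:C * B i j.
Proof. by rewrite mul_diag_mx !mxE. Qed.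

Lemma rtr_rdiag n (l : 'I_n -> R) (B : 'M[C]_n) :
  rtr (rdiag l *m B) = \sum_i l i * complex.Re (B i i).
Proof.
rewrite /rtr /mxtrace Re_sum; apply: eq_bigr => i _.
by rewrite rdiag_mulE Re_scale.
Qed.

(** The rows of [U] are orthonormal left eigenvectors. Leaving [U] and [l] free lets a multiple of
    [A] be diagonalized by the same [U]. *)
Definition eigendec n (A U : 'M[C]_n) (l : 'I_n -> R) : Prop :=
  U *m adjmx U = 1%:M /\ A = adjmx U *m rdiag l *m U.

Lemma unitary_adjl n (U : 'M[C]_n) : U *m adjmx U = 1%:M -> adjmx U *m U = 1%:M.
Proof. exact: mulmx1C. Qed.

Lemma eigendec_diag n (A U : 'M[C]_n) l :
  eigendec A U l -> U *m A *m adjmx U = rdiag l.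
Proof.
by move=> [hU ->]; rewrite !mulmxA hU mul1mx -mulmxA hU mulmx1.
Qed.

Definition spec n (A : 'M[C]_n) (i : 'I_n) : R := complex.Re (spectral_diag A 0 i).

Lemma spec_eigendec n (A : 'M[C]_n) : psdmx A -> eigendec A (spectralmx A) (spec A).
Proof.
move=> [Aherm _].
have UE : (spectralmx A)^t* = adjmx (spectralmx A) by rewrite /adjmx map_trmx.
have dE : rdiag (spec A) = diag_mx (spectral_diag A).
  congr diag_mx; apply/rowP => i; rewrite mxE RRe_real//.
  by have /mxOverP := hermitian_spectral_diag_real Aherm; apply.
split; first by rewrite -UE; apply/unitarymxP/spectral_unitarymx.
rewrite dE -UE -invmx_unitary ?spectral_unitarymx//.
by apply/orthomx_spectralP/hermitian_normalmx.
Qed.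

Lemma spec_ge0 n (A : 'M[C]_n) i : psdmx A -> 0 <= spec A i.
Proof.
move=> hA; have := psdmx_diag_ge0 (spectralmx A) i hA.
by rewrite (eigendec_diag (spec_eigendec hA)) !mxE eqxx mulr1n => /Re_ge0.
Qed.

Lemma rtr_eigen n (A U B : 'M[C]_n) l : eigendec A U l ->
  rtr (A *m B) = \sum_i l i * complex.Re ((U *m B *m adjmx U) i i).
Proof.
move=> [_ ->]; rewrite -mulmxA rtrC mulmxA rtrC -!mulmxA rtr_rdiag.
by under eq_bigr do rewrite mulmxA.
Qed.

(** In an eigenbasis of [A], the trace pairs nonnegative eigenvalues with nonnegative diagonal
    entries of [B]. *)
Lemma rtr_mul_psd_ge0 n (A B : 'M[C]_n) : psdmx A -> psdmx B -> 0 <= rtr (A *m B).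
Proof.
move=> hA hB; rewrite (rtr_eigen _ (spec_eigendec hA)) sumr_ge0// => i _.
by rewrite mulr_ge0 ?spec_ge0// Re_ge0// psdmx_diag_ge0.
Qed.

Lemma rtr_psd_ge0 n (A : 'M[C]_n) : psdmx A -> 0 <= rtr A.
Proof. by move=> h; rewrite -[A]mulmx1; apply: rtr_mul_psd_ge0 => //; apply: psdmx1. Qed.

(** The transition probability |<u_i, v_j>|^2 between row i of [U] and row j of [V]. *)
Definition overlap n (U V : 'M[C]_n) i j : R := sqmod ((U *m adjmx V) i j).

Lemma overlap_ge0 n (U V : 'M[C]_n) i j : 0 <= overlap U V i j.
Proof. exact: sqmod_ge0. Qed.

Lemma unitary_row_sqmod n (T : 'M[C]_n) i :
  T *m adjmx T = 1%:M -> \sum_j sqmod (T i j) = 1.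
Proof.
move=> hT; apply: (@complexI R); rewrite real_complex_sum.
have := congr1 (fun M : 'M[C]_n => M i i) hT.
rewrite [in RHS]mxE eqxx mxE => hTi; apply: etrans hTi; apply: eq_bigr => j _.
by rewrite adjmxE mul_conj_sqmod.
Qed.

Lemma overlap_sumr n (U V : 'M[C]_n) i :
  U *m adjmx U = 1%:M -> V *m adjmx V = 1%:M -> \sum_j overlap U V i j = 1.
Proof.
move=> hU hV; apply: unitary_row_sqmod.
by rewrite adjmxM adjmxK -mulmxA (mulmxA (adjmx V)) unitary_adjl// mul1mx.
Qed.

(** For a state [A] and unitary [V], the outcome law of a measurement in the basis formed by the
    rows of [V]. *)
Definition pinch n (V A : 'M[C]_n) j : R := complex.Re ((V *m A *m adjmx V) j j).

Lemma pinch_ge0 n (V A : 'M[C]_n) j : psdmx A -> 0 <= pinch V A j.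
Proof. by move=> /(psdmx_diag_ge0 V j) /Re_ge0. Qed.

Lemma pinch_avg (X : finType) n (V : 'M[C]_n) (p : X -> R) rho j :
  pinch V (avg_state p rho) j = \sum_x p x * pinch V (rho x) j.
Proof.
rewrite /pinch /avg_state mulmx_sumr mulmx_suml summxE Re_sum; apply: eq_bigr => x _.
by rewrite -scalemxAr -scalemxAl mxE Re_scale.
Qed.

Lemma pinchZB n (V A B : 'M[C]_n) (a : R) j :
  pinch V (a%:C *: A - B) j = a * pinch V A j - pinch V B j.
Proof.
by rewrite /pinch mulmxBr mulmxBl -scalemxAr -scalemxAl !mxE Re_sub Re_scale.
Qed.

Lemma pinch_eigen n (A U V : 'M[C]_n) l j :
  eigendec A U l -> pinch V A j = \sum_i l i * overlap U V i j.
Proof.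
move=> [hU ->]; rewrite /pinch.
rewrite (_ : _ *m _ = adjmx (U *m adjmx V) *m (rdiag l *m (U *m adjmx V))); last first.
  by rewrite adjmxM adjmxK !mulmxA.
rewrite mxE Re_sum; apply: eq_bigr => i _.
by rewrite rdiag_mulE adjmxE mulrCA Re_scale; congr (_ * _); rewrite mulrC mul_conj_sqmod.
Qed.

Lemma pinch_self n (A U : 'M[C]_n) l j : eigendec A U l -> pinch U A j = l j.
Proof. by move=> h; rewrite /pinch (eigendec_diag h) !mxE eqxx mulr1n. Qed.

Lemma eigendec_rtr n (A U : 'M[C]_n) l : eigendec A U l -> rtr A = \sum_i l i.
Proof.
move=> [hU ->]; rewrite rtrC mulmxA hU mul1mx -[rdiag l]mulmx1 rtr_rdiag.
by apply: eq_bigr => i _; rewrite mxE eqxx mulr1.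
Qed.

End Matrices.

(** * The variational formula for Q_s *)

Section RelativeEntropy.
Variable R : realType.
Local Notation C := R[i].

Lemma Re_mul_adj_diag n (A B : 'M[C]_n) i :
  complex.Re ((A *m adjmx B) i i) = \sum_j complex.Re (A i j * Num.conj (B i j)).
Proof. by rewrite mxE Re_sum; apply: eq_bigr => j _; rewrite adjmxE. Qed.

Definition varform n (s : R) (rho sigma Z : 'M[C]_n) : R :=
  2 * rtr (rho *m Z) - (1 - s) * rtr (rho *m (Z *m adjmx Z))
    - s * rtr (sigma *m (adjmx Z *m Z)).

(** In the two eigenbases the form decouples: each entry of [Y] has its own quadratic, which can be
    maximized separately. *)
Lemma varformE n s (rho sigma U V Y : 'M[C]_n) l m :
  eigendec rho U l -> eigendec sigma V m ->
  varform s rho sigma (adjmx U *m Y *m V) =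
  \sum_i \sum_j (2 * (l i * complex.Re (Y i j * Num.conj ((U *m adjmx V) i j)))
                 - ((1 - s) * l i + s * m j) * sqmod (Y i j)).
Proof.
move=> hr hs; have [hU _] := hr; have [hV _] := hs.
rewrite /varform !(rtr_eigen _ hr) (rtr_eigen _ hs) !adjmxM adjmxK.
have -> : U *m (adjmx U *m Y *m V) *m adjmx U = Y *m adjmx (U *m adjmx V).
  by rewrite adjmxM adjmxK !mulmxA hU mul1mx.
have -> : U *m (adjmx U *m Y *m V *m (adjmx V *m (adjmx Y *m U))) *m adjmx U =
    Y *m adjmx Y.
  by rewrite !mulmxA hU mul1mx -(mulmxA Y) hV mulmx1 -mulmxA hU mulmx1.
have -> : V *m (adjmx V *m (adjmx Y *m U) *m (adjmx U *m Y *m V)) *m adjmx V =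
    adjmx Y *m adjmx (adjmx Y).
  rewrite adjmxK !mulmxA hV mul1mx -(mulmxA (adjmx Y)) hU mulmx1.
  by rewrite -mulmxA hV mulmx1.
under [X in 2 * X]eq_bigr do rewrite Re_mul_adj_diag mulr_sumr.
under [X in (1 - s) * X]eq_bigr do rewrite Re_mul_adj_diag mulr_sumr.
under [X in _ - s * X]eq_bigr do rewrite Re_mul_adj_diag mulr_sumr.
rewrite [X in _ - s * X]exchange_big/= !mulr_sumr -!sumrB.
apply: eq_bigr => i _; rewrite !mulr_sumr -!sumrB; apply: eq_bigr => j _.
rewrite !adjmxE conjCK mul_conj_sqmod [_^* * _]mulrC mul_conj_sqmod /=.
ring.
Qed.

Definition resolvent n (s : R) (U V : 'M[C]_n) (l m : 'I_n -> R) : R :=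
  \sum_i \sum_j l i ^+ 2 * overlap U V i j / ((1 - s) * l i + s * m j).

(** Inclusion of the support of rho in that of sigma, read on eigenvectors: u_i with l_i nonzero is
    orthogonal to v_j with m_j zero. *)
Definition dominated n (U V : 'M[C]_n) (l m : 'I_n -> R) : Prop :=
  forall i j, m j = 0 -> l i * overlap U V i j = 0.

Lemma dominated_pinch n (rho U V : 'M[C]_n) l m :
  eigendec rho U l -> (forall i, 0 <= l i) ->
  (forall j, m j = 0 -> pinch V rho j = 0) -> dominated U V l m.
Proof.
move=> hr l0 H i j /H; rewrite (pinch_eigen _ _ hr) => /eqP.
rewrite psumr_eq0 => [|k _]; last by rewrite mulr_ge0 ?overlap_ge0.
by move=> /allP /(_ i (mem_index_enum i)) /eqP.
Qed.

Section Variational.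
Variables (n : nat) (s : R) (rho sigma U V : 'M[C]_n) (l m : 'I_n -> R).
Hypotheses (hr : eigendec rho U l) (hs : eigendec sigma V m).
Hypotheses (l0 : forall i, 0 <= l i) (m0 : forall i, 0 <= m i).
Hypotheses (dom : dominated U V l m) (s0 : 0 < s) (s1 : s <= 1).

(** As s > 0, the coefficient vanishes only if m_j = 0, and domination then kills the linear term of
    the entry. Such entries contribute 0 to [varform], and also to [resolvent] because 0^-1 = 0. *)
Lemma denominator_cases i j : 0 < (1 - s) * l i + s * m j \/
  (1 - s) * l i + s * m j = 0 /\ (l i = 0 \/ (U *m adjmx V) i j = 0).
Proof.
have sl : 0 <= (1 - s) * l i by rewrite mulr_ge0// subr_ge0.
have [mj|mj] := eqVneq (m j) 0; last first.
  by left; rewrite ltr_wpDl// mulr_gt0// lt_neqAle eq_sym mj m0.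
rewrite mj mulr0 addr0; have [d0|d0] := eqVneq ((1 - s) * l i) 0; last first.
  by left; rewrite lt_neqAle eq_sym d0.
right; split => //.
have /eqP := dom i mj; rewrite mulf_eq0 => /orP[/eqP|]; first by left.
rewrite /overlap /sqmod paddr_eq0 ?sqr_ge0// !sqrf_eq0 => /andP[a b]; right.
by apply/eqP; rewrite eq_complex a b.
Qed.

Lemma varform_le Z : varform s rho sigma Z <= resolvent s U V l m.
Proof.
have [hU _] := hr; have [hV _] := hs.
(* Unitarity puts every Z in the form required by [varformE]. *)
have -> : Z = adjmx U *m (U *m Z *m adjmx V) *m V.
  by rewrite !mulmxA unitary_adjl// mul1mx -mulmxA unitary_adjl// mulmx1.
rewrite (varformE _ _ hr hs); apply: ler_sum => i _; apply: ler_sum => j _.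
case: (denominator_cases i j) => [|[-> H]]; first exact: quadratic_le.
rewrite invr0 mulr0 mul0r subr0; case: H => ->; first by rewrite mul0r mulr0.
by rewrite conjC0 mulr0 mulr0 mulr0.
Qed.

Lemma varform_attained : exists Z, varform s rho sigma Z = resolvent s U V l m.
Proof.
(* The maximizer of [quadratic_eq], entry by entry. *)
pose Y := \matrix_(i, j) ((l i / ((1 - s) * l i + s * m j))%:C * (U *m adjmx V) i j).
exists (adjmx U *m Y *m V).
rewrite (varformE _ _ hr hs); apply: eq_bigr => i _; apply: eq_bigr => j _.
rewrite [Y i j]mxE; case: (denominator_cases i j) => [h|[-> _]].
  by rewrite quadratic_eq// gt_eqF.
by rewrite invr0 !mulr0 !mul0r subr0 /= !mulr0.
Qed.

End Variational.

(** * Relative entropy as a classical sum over pairs of eigenvectors *)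

Lemma mul_inv_ratio (s r q : R) :
  r * (1 - s + s * (q / r))^-1 = r ^+ 2 / ((1 - s) * r + s * q).
Proof.
have [->|r0] := eqVneq r 0; first by rewrite expr0n /= !mul0r.
have -> : 1 - s + s * (q / r) = ((1 - s) * r + s * q) / r by field.
by rewrite invfM invrK; ring.
Qed.

(* [tr(rho ln rho) - tr(rho ln sigma)], the spectrum of [rho] being [l] and
   [(V, m)] diagonalizing [sigma]; zero eigenvalues drop out since [ln 0 = 0]. *)
Definition relent n (l : 'I_n -> R) (V : 'M[C]_n) (m : 'I_n -> R) (rho : 'M[C]_n) : R :=
  \sum_i l i * ln (l i) - \sum_j pinch V rho j * ln (m j).

(** Together with m_j |<u_i, v_j>|^2, these weights form the Nussbaum-Szkola pair of distributions,
    whose classical relative entropy is the quantum one. Their likelihood ratio is [pair_ratio]. *)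
Definition pair_weight n (U V : 'M[C]_n) (l : 'I_n -> R) (p : 'I_n * 'I_n) : R :=
  l p.1 * overlap U V p.1 p.2.

Definition pair_ratio n (l m : 'I_n -> R) (p : 'I_n * 'I_n) : R := m p.2 / l p.1.

Section Pairs.
Variables (n : nat) (rho sigma U V : 'M[C]_n) (l m : 'I_n -> R).
Hypotheses (hr : eigendec rho U l) (hs : eigendec sigma V m).
Hypotheses (l0 : forall i, 0 <= l i) (m0 : forall i, 0 <= m i).
Hypotheses (dom : dominated U V l m).

Lemma pair_weight_ge0 p : 0 <= pair_weight U V l p.
Proof. by rewrite mulr_ge0 ?overlap_ge0. Qed.

Lemma pair_ratio_gt0 p : pair_weight U V l p != 0 -> 0 < pair_ratio l m p.
Proof.
case: p => i j; rewrite /pair_weight /pair_ratio /= => h.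
have li : l i != 0 by apply: contraNneq h => ->; rewrite mul0r.
have mj : m j != 0 by apply: contraNneq h => /(dom i)->.
by rewrite divr_gt0// lt_neqAle eq_sym ?li ?mj ?l0 ?m0.
Qed.

Lemma sum_pair_weight : \sum_p pair_weight U V l p = rtr rho.
Proof.
have [hU _] := hr; have [hV _] := hs.
rewrite (eigendec_rtr hr) -(pair_bigA _ (fun i j => l i * overlap U V i j))/=.
by apply: eq_bigr => i _; rewrite -mulr_sumr overlap_sumr ?mulr1.
Qed.

Lemma resolvent_pairs s : resolvent s U V l m =
  \sum_p pair_weight U V l p * (1 - s + s * pair_ratio l m p)^-1.
Proof.
rewrite /resolvent pair_bigA/=; apply: eq_bigr => -[i j] _.
by rewrite /pair_weight /pair_ratio /= [RHS]mulrAC mul_inv_ratio mulrAC.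
Qed.

Lemma relent_pairs : relent l V m rho =
  - \sum_p pair_weight U V l p * ln (pair_ratio l m p).
Proof.
have [hU _] := hr; have [hV _] := hs.
rewrite /relent.
under [X in _ - X]eq_bigr do rewrite (pinch_eigen _ _ hr) mulr_suml.
rewrite exchange_big/= -sumrB.
rewrite -(pair_bigA _ (fun i j => l i * overlap U V i j * ln (m j / l i)))/= -sumrN.
apply: eq_bigr => i _.
(* Inserting 1 as the sum over j of the overlaps turns the entropy term into a sum over pairs as
   well. *)
rewrite -[l i * ln (l i)]mulr1 -(overlap_sumr i hU hV) mulr_sumr -sumrB -sumrN.
apply: eq_bigr => j _.
have [h|h] := eqVneq (l i * overlap U V i j) 0.
  by rewrite mulrAC h !mul0r subr0 oppr0.
have li : l i != 0 by apply: contraNneq h => ->; rewrite mul0r.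
have mj : m j != 0 by apply: contraNneq h => /(dom i)->.
by rewrite ln_div ?posrE ?lt_neqAle 1?eq_sym ?li ?mj ?l0 ?m0//; ring.
Qed.

End Pairs.

(* [\sum_y (z_y - Z) F_y (z_y - Z) = \sum_y z_y^2 F_y - Z^2] *)
Lemma povm_kadison n k (A : 'M[C]_n) (F : 'I_k -> 'M[C]_n) (z : 'I_k -> R) :
  psdmx A -> povm F ->
  forall Z, Z = \sum_y (z y)%:C *: F y ->
  rtr (A *m (Z *m Z)) <= \sum_y z y ^+ 2 * rtr (A *m F y).
Proof.
move=> hA [hF F1] Z ZE.
have Zadj : adjmx Z = Z.
  by rewrite ZE adjmx_sum; apply: eq_bigr => y _; rewrite adjmxZ psdmx_adj.
pose G y := (z y)%:C%:M - Z.
have Gadj y : adjmx (G y) = G y.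
  rewrite /G adjmxB Zadj; congr (_ - _).
  by rewrite -scalemx1 adjmxZ adjmx1.
have E : \sum_y G y *m F y *m adjmx (G y) =
    (\sum_y ((z y) ^+ 2)%:C *: F y) - Z *m Z.
  under eq_bigr do rewrite Gadj /G mulmxBl mulmxBr !mulmxBl mul_scalar_mx
    mul_mx_scalar scalerA -rmorphM -expr2 -scalemxAl mul_mx_scalar.
  rewrite !sumrB.
  have -> : \sum_y (z y)%:C *: (F y *m Z) = Z *m Z.
    by rewrite {2}ZE mulmx_suml; apply: eq_bigr => y _; rewrite -scalemxAl.
  have -> : \sum_y (z y)%:C *: (Z *m F y) = Z *m Z.
    by rewrite {3}ZE mulmx_sumr; apply: eq_bigr => y _; rewrite -scalemxAr.
  have -> : \sum_y Z *m F y *m Z = Z *m Z.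
    by rewrite -mulmx_suml -mulmx_sumr F1 mulmx1.
  by rewrite subrr subr0.
have : 0 <= rtr (A *m \sum_y G y *m F y *m adjmx (G y)).
  rewrite mulmx_sumr rtr_sum sumr_ge0// => y _.
  by apply: rtr_mul_psd_ge0 => //; apply: psdmx_congr.
rewrite E mulmxBr rtrB subr_ge0 mulmx_sumr rtr_sum => /le_trans; apply.
by apply: ler_sum => y _; rewrite -scalemxAr rtrZ.
Qed.

End RelativeEntropy.

(** * Measurement bounds and comparison with log mu *)

Section Bounds.
Variable R : realType.
Local Notation C := R[i].

(** Data processing for a measurement. By [le_sum_ln] it suffices to bound the classical Q_s of the
    two outcome laws by the quantum one, for each s. *)
Lemma measured_relent_le n k (rho sigma U V : 'M[C]_n) l m (F : 'I_k -> 'M[C]_n) :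
  psdmx rho -> psdmx sigma -> povm F ->
  eigendec rho U l -> eigendec sigma V m ->
  (forall i, 0 <= l i) -> (forall i, 0 <= m i) -> dominated U V l m ->
  (forall y, rtr (rho *m F y) != 0 -> 0 < rtr (sigma *m F y)) ->
  - (\sum_y rtr (rho *m F y) * ln (rtr (sigma *m F y) / rtr (rho *m F y)))
    <= relent l V m rho.
Proof.
move=> prho psigma hF hr hs l0 m0 dom hq; have [F0 F1] := hF.
pose r y := rtr (rho *m F y); pose q y := rtr (sigma *m F y).
have r0 y : 0 <= r y by apply: rtr_mul_psd_ge0.
rewrite (relent_pairs hr hs)// lerN2; apply: le_sum_ln => //.
- exact: pair_weight_ge0.
- exact: pair_ratio_gt0.
- by move=> y ry; rewrite divr_gt0 ?hq// lt_neqAle eq_sym ry r0.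
- by rewrite (sum_pair_weight hr hs) -rtr_sum -mulmx_sumr F1 mulmx1.
move=> s s0 s1; rewrite -resolvent_pairs.
(* The maximizer of 2 z r_y - z^2 ((1 - s) r_y + s q_y), whose maximum is the y-th term of the
   classical Q_s. *)
pose z y := r y / ((1 - s) * r y + s * q y).
pose Z := \sum_y (z y)%:C *: F y.
have Zadj : adjmx Z = Z.
  by rewrite adjmx_sum; apply: eq_bigr => y _; rewrite adjmxZ psdmx_adj.
apply: le_trans (varform_le hr hs l0 m0 dom s0 s1 Z).
rewrite /varform Zadj.
have kr : rtr (rho *m (Z *m Z)) <= \sum_y z y ^+ 2 * r y by apply: povm_kadison.
have ks : rtr (sigma *m (Z *m Z)) <= \sum_y z y ^+ 2 * q y by apply: povm_kadison.
have rZ : rtr (rho *m Z) = \sum_y z y * r y.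
  rewrite mulmx_sumr rtr_sum; apply: eq_bigr => y _.
  by rewrite -scalemxAr rtrZ.
apply: (@le_trans _ _ (2 * (\sum_y z y * r y) - (1 - s) * (\sum_y z y ^+ 2 * r y)
   - s * (\sum_y z y ^+ 2 * q y))); last first.
  rewrite rZ -!addrA lerD2l lerD// lerN2 ler_wpM2l//; last exact: ltW.
  by rewrite subr_ge0.
rewrite !mulr_sumr -!sumrB; apply: ler_sum => y _.
rewrite mul_inv_ratio -/(r y) -/(q y) /z.
have [->|d0] := eqVneq ((1 - s) * r y + s * q y) 0.
  by rewrite invr0 !mulr0 expr0n/= !mul0r !mulr0 !subr0.
by rewrite le_eqVlt; apply/orP; left; apply/eqP; field.
Qed.

Lemma povm_trivial n : povm (fun _ : 'I_1 => 1%:M : 'M[C]_n).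
Proof. by split => [y|]; [exact: psdmx1 | rewrite big_ord1]. Qed.

(** Measuring with the one-outcome POVM gives two identical outcome laws, of relative entropy 0. *)
Lemma relent_ge0 n (rho sigma U V : 'M[C]_n) l m :
  psdmx rho -> psdmx sigma -> rtr rho = 1 -> rtr sigma = 1 ->
  eigendec rho U l -> eigendec sigma V m ->
  (forall i, 0 <= l i) -> (forall i, 0 <= m i) -> dominated U V l m ->
  0 <= relent l V m rho.
Proof.
move=> pr ps r1 s1 hr hs l0 m0 dom.
have := measured_relent_le pr ps (povm_trivial n) hr hs l0 m0 dom.
rewrite big_ord1 !mulmx1 r1 s1 divr1 ln1 mulr0 oppr0; apply => y _.
exact: ltr01.
Qed.

Lemma overlap_self n (U : 'M[C]_n) i j :
  U *m adjmx U = 1%:M -> overlap U U i j = (i == j)%:R.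
Proof.
move=> hU; rewrite /overlap hU mxE /sqmod; case: (i == j) => /=.
  by rewrite expr1n expr0n addr0.
by rewrite expr0n addr0.
Qed.

Lemma rdiagZ n (a : R) (l : 'I_n -> R) : rdiag (fun i => a * l i) = a%:C *: rdiag l.
Proof.
apply/matrixP => i j; rewrite !mxE; case: (i == j); last by rewrite !mulr0n mulr0.
by rewrite !mulr1n rmorphM.
Qed.

Lemma eigendecZ n (a : R) (A U : 'M[C]_n) l :
  eigendec A U l -> eigendec (a%:C *: A) U (fun i => a * l i).
Proof.
move=> [hU ->]; split => //.
by rewrite rdiagZ -scalemxAr -scalemxAl.
Qed.

Lemma relent_le_ln n (rho sigma U V : 'M[C]_n) l m (mu : R) :
  0 < mu -> rtr rho = 1 -> loewner rho (mu%:C *: sigma) ->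
  eigendec rho U l -> eigendec sigma V m ->
  (forall i, 0 <= l i) -> (forall i, 0 <= m i) -> dominated U V l m ->
  relent l V m rho <= ln mu.
Proof.
move=> mu0 r1 hle hr hs l0 m0 dom; have [hU _] := hr.
rewrite (relent_pairs hr hs)// lerNl -lnV ?posrE//.
(* The comparison is with a one-point distribution of likelihood ratio 1 / mu, the value expected of
   the pair rho, rho / mu. *)
have := @le_sum_ln R 'I_1 _ (fun=> 1) (fun=> mu^-1) (pair_weight U V l) (pair_ratio l m).
rewrite !big_ord1 mul1r; apply => //.
- exact: pair_weight_ge0.
- by move=> _ _; rewrite invr_gt0.
- exact: pair_ratio_gt0.
- by rewrite (sum_pair_weight hr hs).
move=> s s0 s1; rewrite -resolvent_pairs big_ord1 mul1r.
(* The optimal Z for sigma serves as a trial matrix for rho / mu. *)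
have [Z <-] := varform_attained hr hs l0 m0 dom s0 s1.
have hr' := eigendecZ mu^-1 hr.
have dom' : dominated U U l (fun i => mu^-1 * l i).
  apply: (dominated_pinch hr) => // j /eqP.
  by rewrite (pinch_self _ hr) mulf_eq0 invr_eq0 gt_eqF//= => /eqP.
have l0' i : 0 <= mu^-1 * l i by rewrite mulr_ge0// invr_ge0 ltW.
have le2 := varform_le hr hr' l0 l0' dom' s0 s1 Z.
have d0 : 0 < 1 - s + s / mu.
  by rewrite ltr_wpDl ?subr_ge0// divr_gt0.
(* The matrices rho and rho / mu share an eigenbasis, so only the diagonal terms l_i / (1 - s + s /
   mu) survive. *)
have E : resolvent s U U l (fun i => mu^-1 * l i) = (1 - s + s / mu)^-1.
  transitivity (rtr rho * (1 - s + s / mu)^-1); last by rewrite r1 mul1r.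
  rewrite /resolvent (eigendec_rtr hr) mulr_suml.
  apply: eq_bigr => i _; rewrite (bigD1 i)//= big1 ?addr0 => [|j ji].
    rewrite overlap_self// eqxx mulr1.
    have [->|li] := eqVneq (l i) 0; first by rewrite expr0n/= !mul0r.
    have -> : (1 - s) * l i + s * (mu^-1 * l i) = l i * (1 - s + s / mu) by ring.
    by rewrite invfM expr2 -mulrA mulVKf.
  by rewrite overlap_self// eq_sym (negbTE ji) mulr0 mul0r.
rewrite -E; apply: le_trans le2.
rewrite /varform lerD2l lerN2 ler_wpM2l//; first exact: ltW.
have ZZ : psdmx (adjmx Z *m Z).
  by have := psdmx_congr (adjmx Z) (psdmx1 R n); rewrite mulmx1 adjmxK.
have := rtr_mul_psd_ge0 hle ZZ.
by rewrite mulmxBl rtrB -!scalemxAl !rtrZ subr_ge0 ler_pdivrMl.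
Qed.

(** * Support inclusion and the Loewner order *)

Lemma psdmxD n (A B : 'M[C]_n) : psdmx A -> psdmx B -> psdmx (A + B).
Proof.
move=> [/hermsymmx_adj hA A0] [/hermsymmx_adj hB B0]; split.
  by apply/hermsymmx_adj; rewrite adjmxD hA hB.
by move=> v; rewrite mulmxDr mulmxDl mxE addr_ge0.
Qed.

Lemma rdiag_adj n (l : 'I_n -> R) : adjmx (rdiag l) = rdiag l.
Proof.
apply/matrixP => i j; rewrite adjmxE !mxE eq_sym.
have [->|_] := eqVneq i j; first by rewrite !mulr1n; apply: conjc_real.
by rewrite !mulr0n conjC0.
Qed.

Lemma rdiagB n (l m : 'I_n -> R) : rdiag l - rdiag m = rdiag (fun i => l i - m i).
Proof. by apply/matrixP => i j; rewrite !mxE -mulrnBl -rmorphB. Qed.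

Lemma rdiagM n (l m : 'I_n -> R) : rdiag l *m rdiag m = rdiag (fun i => l i * m i).
Proof.
apply/matrixP => i j; rewrite rdiag_mulE !mxE; case: (i == j).
  by rewrite !mulr1n rmorphM.
by rewrite !mulr0n mulr0.
Qed.

Lemma psdmx_rdiag n (l : 'I_n -> R) : (forall i, 0 <= l i) -> psdmx (rdiag l).
Proof.
move=> l0; split; first exact/hermsymmx_adj/rdiag_adj.
move=> v; rewrite mxE sumr_ge0// => i _.
rewrite adjmxE mul_mx_diag !mxE mulrAC mulr_ge0 ?mul_conjC_ge0//.
by rewrite ler0c.
Qed.

(** Each eigenvalue is at most the sum of all of them, as they are nonnegative. *)
Lemma loewner_trace n (rho : 'M[C]_n) :
  psdmx rho -> loewner rho (rdiag (fun=> rtr rho)).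
Proof.
move=> pr; have hr := spec_eigendec pr; have [hU rE] := hr.
set U := spectralmx rho in hr hU rE; set l := spec rho in hr rE.
rewrite /loewner.
have -> : rdiag (fun=> rtr rho) - rho =
   adjmx U *m rdiag (fun i => rtr rho - l i) *m adjmx (adjmx U).
  rewrite -rdiagB mulmxBr mulmxBl adjmxK -rE; congr (_ - _).
  have -> : rdiag (fun=> rtr rho) = (rtr rho)%:C%:M :> 'M[C]_n.
    by apply/matrixP => i j; rewrite !mxE.
  by rewrite mul_mx_scalar -scalemxAl unitary_adjl// scalemx1.
apply: psdmx_congr; apply: psdmx_rdiag => i.
rewrite subr_ge0 (eigendec_rtr hr) (bigD1 i)//= lerDl.
by apply: sumr_ge0 => j _; apply: spec_ge0.
Qed.

(* If [P] projects onto the support of [sigma], then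
   [rho = P rho P <= tr(rho) P <= K sigma]. *)
Lemma loewner_of_submx n (rho sigma : 'M[C]_n) :
  psdmx rho -> psdmx sigma -> (rho <= sigma)%MS ->
  exists mu : R, loewner rho (mu%:C *: sigma).
Proof.
move=> pr ps /submxP[D rhoD]; have hs := spec_eigendec ps.
set V := spectralmx sigma in hs; set m := spec sigma in hs; have [hV sE] := hs.
have m_ge0 i : 0 <= m i by apply: spec_ge0.
pose t := rtr rho; have t0 : 0 <= t by apply: rtr_psd_ge0.
(* Zero eigenvalues add 0 to this sum, as t / 0 = 0; the others give K m_i >= t whenever m_i is
   nonzero. *)
pose K := \sum_j t / m j; exists K.
pose P := rdiag (fun i => (m i != 0)%:R : R).
pose B := V *m rho *m adjmx V.
have Badj : adjmx B = B by rewrite /B !adjmxM adjmxK psdmx_adj// mulmxA.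
(* Taking adjoints in rho = D sigma puts sigma on the left, so the rows of [B] with m_i = 0
   vanish. *)
have PB : P *m B = B.
  have -> : B = rdiag m *m (V *m adjmx D *m adjmx V).
    rewrite /B -(psdmx_adj pr) rhoD adjmxM (psdmx_adj ps) sE.
    by rewrite !mulmxA hV mul1mx.
  rewrite mulmxA rdiagM; congr (_ *m _); congr rdiag.
  by apply/funext => i; case: eqVneq => [->|_]; rewrite ?mul0r ?mul1r.
have BP : B *m P = B by rewrite -{1}Badj -[P]rdiag_adj -adjmxM PB.
have h1 : psdmx (rdiag (fun i => t * (m i != 0)%:R) - B).
  have := psdmx_congr P (psdmx_congr V (loewner_trace pr)).
  rewrite mulmxBr mulmxBl -/B -/t [adjmx P]rdiag_adj mulmxBr mulmxBl PB BP.
  have -> : rdiag (fun=> t) = t%:C%:M :> 'M[C]_n.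
    by apply/matrixP => i j; rewrite !mxE.
  rewrite mul_mx_scalar -scalemxAl hV -scalemxAr mulmx1 -scalemxAl -/P.
  rewrite [P *m P]rdiagM -rdiagZ.
  by under [fun i => t * (_ * _)]funext do rewrite -natrM mulnb andbb.
have h2 : psdmx (rdiag (fun i => K * m i) - rdiag (fun i => t * (m i != 0)%:R)).
  rewrite rdiagB; apply: psdmx_rdiag => i; rewrite subr_ge0.
  have [->|mi] := eqVneq (m i) 0; first by rewrite !mulr0.
  rewrite mulr1 /K (bigD1 i)//= mulrDl mulfVK// lerDl mulr_ge0//.
  by apply: sumr_ge0 => j _; rewrite divr_ge0.
have := psdmx_congr (adjmx V) (psdmxD h2 h1); rewrite adjmxK subrKA mulmxBr mulmxBl.
rewrite rdiagZ -scalemxAr -scalemxAl -sE /B !mulmxA unitary_adjl// mul1mx.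
by rewrite -mulmxA unitary_adjl// mulmx1.
Qed.

End Bounds.

(** * Holevo information as an average relative entropy *)

Section Ensembles.
Variable R : realType.
Local Notation C := R[i].

Definition qrelent n (rho sigma : 'M[C]_n) : R :=
  relent (spec rho) (spectralmx sigma) (spec sigma) rho.

Lemma ln2_gt0 : 0 < ln (2 : R).
Proof. by rewrite ln_gt0// ltr1n. Qed.

Lemma vn_entropyE n (rho : 'M[C]_n) :
  vn_entropy rho = - (\sum_i spec rho i * ln (spec rho i)) / ln 2.
Proof.
rewrite /vn_entropy mulNr mulr_suml; congr (- _); apply: eq_bigr => i _.
rewrite /xlog2x -/(spec rho i) /log2; case: eqVneq => [->|_].
  by rewrite !mul0r.
by rewrite mulrA.
Qed.

Lemma density_rtr n (rho : 'M[C]_n) : density rho -> rtr rho = 1.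
Proof. by move=> [_ h]; rewrite /rtr h. Qed.

Lemma rtr_avg (X : finType) n (p : X -> R) (rho : X -> 'M[C]_n) (B : 'M[C]_n) :
  rtr (avg_state p rho *m B) = \sum_x p x * rtr (rho x *m B).
Proof.
rewrite /avg_state mulmx_suml rtr_sum; apply: eq_bigr => x _.
by rewrite -scalemxAl rtrZ.
Qed.

Lemma avg_density_rtr (X : finType) n (p : X -> R) (rho : X -> 'M[C]_n) :
  \sum_x p x = 1 -> (forall x, density (rho x)) -> rtr (avg_state p rho) = 1.
Proof.
move=> p1 h; rewrite -[avg_state _ _]mulmx1 rtr_avg -p1; apply: eq_bigr => x _.
by rewrite mulmx1 density_rtr ?mulr1.
Qed.

(** The term in sigma is linear in the state, so it only sees the average state. *)
Lemma avg_relent (X : finType) n (p : X -> R) (rho : X -> 'M[C]_n)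
    (l : X -> 'I_n -> R) V m :
  \sum_x p x * relent (l x) V m (rho x) =
  \sum_x p x * (\sum_i l x i * ln (l x i))
    - \sum_j pinch V (avg_state p rho) j * ln (m j).
Proof.
under [X in _ - X]eq_bigr do rewrite pinch_avg mulr_suml.
rewrite exchange_big/= -sumrB; apply: eq_bigr => x _.
rewrite /relent mulrBr; congr (_ - _); rewrite mulr_sumr.
by apply: eq_bigr => j _; rewrite mulrA.
Qed.

Lemma holevoE (X : finType) n (p : X -> R) (rho : X -> 'M[C]_n) :
  psdmx (avg_state p rho) ->
  holevo p rho = (\sum_x p x * qrelent (rho x) (avg_state p rho)) / ln 2.
Proof.
move=> h; rewrite (avg_relent p rho (fun x => spec (rho x))).
under [X in _ - X]eq_bigr do rewrite (pinch_self _ (spec_eigendec h)).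
rewrite /holevo vn_entropyE.
under [X in _ - X = _]eq_bigr do rewrite vn_entropyE mulrA mulrN.
by rewrite -mulr_suml sumrN; ring.
Qed.

(** At such a j, the diagonal entry of mu sigma - rho is minus that of rho, and both matrices are
    positive semi-definite. *)
Lemma loewner_dominated n (rho sigma : 'M[C]_n) (mu : R) :
  psdmx rho -> psdmx sigma -> loewner rho (mu%:C *: sigma) ->
  forall j, spec sigma j = 0 -> pinch (spectralmx sigma) rho j = 0.
Proof.
move=> pr ps hle j sj; apply/eqP; rewrite eq_le pinch_ge0// andbT.
have := pinch_ge0 (spectralmx sigma) j hle.
by rewrite pinchZB (pinch_self _ (spec_eigendec ps)) sj mulr0 sub0r oppr_ge0.
Qed.

(** By [relent_le_ln], the exponential of the relative entropy is a lower bound of the feasible mu.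
    Support inclusion makes that set nonempty, so the bound passes to its infimum. *)
Lemma qrelent_le_Dmax n (rho sigma : 'M[C]_n) : density rho -> density sigma ->
  ((qrelent rho sigma / ln 2)%:E <= Dmax rho sigma)%E.
Proof.
move=> [pr r1] [ps s1]; rewrite /Dmax; case: ifPn => [sub|_]; last exact: leey.
rewrite lee_fin /log2 ler_pM2r ?invr_gt0 ?ln2_gt0//.
(* Taking traces even gives mu >= 1. *)
have mu_gt0 (mu : R) : loewner rho (mu%:C *: sigma) -> 0 < mu.
  move=> /rtr_psd_ge0; rewrite rtrB rtrZ /rtr r1 s1 mulr1 subr_ge0.
  exact: lt_le_trans.
suff h : expR (qrelent rho sigma) <=
    inf [set mu : R | loewner rho (mu%:C *: sigma)]%classic.
  have i0 := lt_le_trans (expR_gt0 _) h.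
  by rewrite -[leLHS]expRK ler_ln ?posrE ?expR_gt0.
apply: lb_le_inf; first exact: loewner_of_submx.
move=> mu hle; rewrite -[leRHS]lnK ?posrE ?mu_gt0// ler_expR.
have hr := spec_eigendec pr; have hs := spec_eigendec ps.
apply: (relent_le_ln (mu_gt0 _ hle) _ hle hr hs).
- by rewrite /rtr r1.
- by move=> i; apply: spec_ge0.
- by move=> i; apply: spec_ge0.
- apply: (dominated_pinch hr); first by move=> i; apply: spec_ge0.
  exact: (loewner_dominated pr ps hle).
Qed.

Lemma pinch_avg_eq0 (X : finType) n (p : X -> R) (rho : X -> 'M[C]_n) V j x :
  (forall x, 0 < p x) -> (forall x, psdmx (rho x)) ->
  pinch V (avg_state p rho) j = 0 -> pinch V (rho x) j = 0.
Proof.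
move=> p0 pr; rewrite pinch_avg => /eqP.
rewrite psumr_eq0 => [|k _]; last by rewrite mulr_ge0 ?pinch_ge0// ltW.
move=> /allP /(_ x (mem_index_enum x)) /=.
by rewrite mulf_eq0 gt_eqF//= => /eqP.
Qed.

(** Mutual information is the average relative entropy from the outcome law of rho_x to that of the
    average state, so [measured_relent_le] applies for each x. *)
Lemma mutual_info_le_holevo (X : finType) n k (p : X -> R) (rho : X -> 'M[C]_n)
    (F : 'I_k -> 'M[C]_n) :
  (forall x, 0 < p x) -> (forall x, psdmx (rho x)) -> povm F ->
  mutual_info p (meas_prob rho F) <= holevo p rho.
Proof.
move=> p0 pr hF; have [F0 _] := hF.
have pavg : psdmx (avg_state p rho) by apply: psdmx_avg => // x; apply: ltW.
rewrite holevoE// mulr_suml /mutual_info; apply: ler_sum => x _.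
pose r x y := rtr (rho x *m F y); pose q y := rtr (avg_state p rho *m F y).
have r0 z y : 0 <= r z y by apply: rtr_mul_psd_ge0.
have qE y : \sum_z p z * meas_prob rho F z y = q y by rewrite /q rtr_avg.
have q0 y : r x y != 0 -> 0 < q y.
  move=> ry; rewrite /q rtr_avg (bigD1 x)//= ltr_pwDl//.
    by rewrite mulr_gt0// lt_neqAle eq_sym ry r0.
  by apply: sumr_ge0 => z _; rewrite mulr_ge0 ?r0// ltW.
have -> : \sum_(y < k) (if p x * meas_prob rho F x y == 0 then 0 else
   p x * meas_prob rho F x y * log2 (p x * meas_prob rho F x y /
     (p x * (\sum_z p z * meas_prob rho F z y)))) =
   p x * - (\sum_y r x y * ln (q y / r x y)) / ln 2.
  rewrite mulrN mulNr -mulrA mulr_suml mulr_sumr -sumrN; apply: eq_bigr => y _.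
  rewrite qE /meas_prob -/(rtr _) -/(r x y) mulf_eq0 gt_eqF//=.
  case: eqVneq => [->|ry]; first by rewrite !mul0r mulr0 oppr0.
  have ry0 : 0 < r x y by rewrite lt_neqAle eq_sym ry r0.
  have -> : p x * r x y / (p x * q y) = (q y / r x y)^-1.
    field; rewrite ry !gt_eqF ?q0//.
  by rewrite /log2 lnV ?posrE ?divr_gt0 ?q0//; ring.
rewrite -!mulrA ler_wpM2l ?(ltW (p0 x))// ler_pM2r ?invr_gt0 ?ln2_gt0//.
have hr := spec_eigendec (pr x); have hs := spec_eigendec pavg.
apply: (measured_relent_le _ _ hF hr hs) => //.
- by move=> i; apply: spec_ge0.
- by move=> i; apply: spec_ge0.
- apply: (dominated_pinch hr); first by move=> i; apply: spec_ge0.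
  move=> j; rewrite -(pinch_self j hs); exact: pinch_avg_eq0.
Qed.

(* The difference is the relative entropy of the average state with respect
   to [sigma]. *)
Lemma holevo_le_avg_qrelent (X : finType) n (p : X -> R) (rho : X -> 'M[C]_n)
    (sigma : 'M[C]_n) :
  (forall x, 0 <= p x) -> \sum_x p x = 1 -> (forall x, density (rho x)) ->
  density sigma -> (forall x, (rho x <= sigma)%MS) ->
  holevo p rho <= (\sum_x p x * qrelent (rho x) sigma) / ln 2.
Proof.
move=> p0 p1 dr [ps s1] sub; have pr x : psdmx (rho x) by have [] := dr x.
have pavg : psdmx (avg_state p rho) by apply: psdmx_avg.
rewrite holevoE// ler_pM2r ?invr_gt0 ?ln2_gt0//.
rewrite !(avg_relent p rho (fun x => spec (rho x))) lerD2l lerN2.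
rewrite -subr_ge0.
under eq_bigr do rewrite (pinch_self _ (spec_eigendec pavg)).
apply: (relent_ge0 pavg ps _ _ (spec_eigendec pavg) (spec_eigendec ps)).
- exact: avg_density_rtr.
- by rewrite /rtr s1.
- by move=> i; apply: spec_ge0.
- by move=> i; apply: spec_ge0.
- apply: (dominated_pinch (spec_eigendec pavg)); first by move=> i; apply: spec_ge0.
  move=> j sj; rewrite pinch_avg big1// => x _.
  have [mu hle] := loewner_of_submx (pr x) ps (sub x).
  by rewrite (loewner_dominated (pr x) ps hle sj) mulr0.
Qed.

Lemma density_avg (X : finType) n (p : X -> R) (rho : X -> 'M[C]_n) :
  Defs.pmf p -> (forall x, density (rho x)) -> density (avg_state p rho).
Proof.
move=> [p0 p1] dr; split; first by apply: psdmx_avg => // x; case: (dr x).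
transitivity (\sum_x (p x)%:C : C); last by rewrite -real_complex_sum p1.
rewrite /avg_state raddf_sum/=.
by apply: eq_bigr => x _; rewrite mxtraceZ; have [_ ->] := dr x; rewrite mulr1.
Qed.

Lemma holevo_le_Bquant (X : finType) n (p : X -> R) (rho : X -> 'M[C]_n) :
  (forall x, 0 <= p x) -> \sum_x p x = 1 -> (forall x, density (rho x)) ->
  ((holevo p rho)%:E <= Bquant rho)%E.
Proof.
move=> p0 p1 dr; apply: le_ereal_inf_tmp => _ /= [pi hpi <-].
have ds := density_avg hpi dr.
set sigma := avg_state pi rho in ds *.
have hD x : (Dmax (rho x) sigma <= \big[maxe/-oo]_x Dmax (rho x) sigma)%E.
  exact: le_bigmax.
(* If some rho_x is not supported in sigma, its [Dmax], and hence the maximum, is infinite. *)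
have [sub|] := boolP [forall x, (rho x <= sigma)%MS]; last first.
  rewrite negb_forall => /existsP[x nx].
  by apply: le_trans (hD x); rewrite /Dmax (negbTE nx) leey.
have {}sub x : (rho x <= sigma)%MS by move/forallP: sub.
have := fun x => le_trans (qrelent_le_Dmax (dr x) ds) (hD x).
case: (\big[maxe/-oo]_x _)%E => [M h| _|h]; last 2 first.
- exact: leey.
(* The value -oo would bound a real number from above at any x, and some x exists because the
   weights sum to 1. *)
- have [x _] : exists x : X, true.
    apply: contrapT => nX; move: p1; rewrite big1 => [/esym/eqP|x _].
      by rewrite oner_eq0.
    by case: nX; exists x.
  by have := h x; rewrite leNgt ltNyr.
rewrite lee_fin; apply: (le_trans (holevo_le_avg_qrelent p0 p1 dr ds sub)).
rewrite [leRHS](_ : M = \sum_x p x * M); last by rewrite -mulr_suml p1 mul1r.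
rewrite mulr_suml; apply: ler_sum => x _.
by rewrite -mulrA ler_wpM2l// -lee_fin h.
Qed.

Lemma avg_state_delta (X : finType) n (rho : X -> 'M[C]_n) x0 :
  avg_state (fun x => (x == x0)%:R) rho = rho x0.
Proof.
rewrite /avg_state (bigD1 x0)//= big1 ?addr0 => [|x /negbTE->].
  by rewrite eqxx scale1r.
by rewrite scale0r.
Qed.

Lemma Bquant_le_Rquant (X : finType) n (rho : X -> 'M[C]_n) (x0 : X) :
  (Bquant rho <= Rquant rho)%E.
Proof.
apply: (@le_trans _ _ (\big[maxe/-oo]_x Dmax (rho x) (rho x0))%E).
  apply: ereal_inf_lbound; exists (fun x => (x == x0)%:R); last first.
    by rewrite avg_state_delta.
  split => [x|]; first by rewrite ler0n.
  by rewrite (bigD1 x0)//= big1 ?addr0 ?eqxx// => x /negbTE->.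
apply: le_bigmax2 => x _; exact: le_bigmax.
Qed.

End Ensembles.

Unset Implicit Arguments.

Theorem proposition5 (R : realType) (X : finType) (n : nat)
  (pX : X -> R) (rho : X -> 'M[R[i]]_n) :
  (forall x, 0 < pX x) ->
  \sum_(x : X) pX x = 1 ->
  (forall x, density (rho x)) ->
  ((acc_info pX rho <= (holevo pX rho)%:E)%E /\
   ((holevo pX rho)%:E <= Bquant rho)%E /\
   (Bquant rho <= Rquant rho)%E).
Proof.
move=> p0 p1 dr; split; [|split].
- apply: ge_ereal_sup => _ /= [[k F] hF <-]; rewrite lee_fin.
  by apply: mutual_info_le_holevo => // x; case: (dr x).
- by apply: holevo_le_Bquant => // x; apply: ltW.
(* The point mass needs a base point; an empty [X] would make the sum of [pX] equal to 0. *)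
- have [/card_gt0P[x0 _]|] := ltnP 0 #|X|; first exact: Bquant_le_Rquant x0.
  rewrite leqn0 => /eqP/card0_eq X0; move: p1; rewrite big1 => [/esym/eqP|x _].
    by rewrite oner_eq0.
  by have := X0 x; rewrite inE.
Qed.
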